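(* If $H$ is a minor of a graph $G$, then $\mu(H)\le\mu(G)$.
   Context: Graphs are finite and simple. For a graph $G$ with vertex set $[n]$, edge set $E(G)$ and set of isolated vertices $Iso(G)$, $I_G$ is the kernel of the $\mathbb{C}$-algebra homomorphism $$\phi_G:\mathbb{C}[p_{i_1\cdots i_n}\mid i_j\in\{0,1\}]\to \mathbb{C}[t^{(j,k)}_{a,b},\,t^{(l)}_{a}\mid \{j,k\}\in E(G),\ l\in Iso(G),\ a,b\in\{0,1\}],$$ $$p_{i_1\cdots i_n}\mapsto \prod_{\{j,k\}\in E(G)}t^{(j,k)}_{i_j,i_k}\prod_{l\in Iso(G)}t^{(l)}_{i_l};$$ it is a homogeneous toric ideal. The Markov width $\mu(G)$ is the largest degree of a minimal generator of $I_G$, i.e. the largest degree of an element of a minimal homogeneous generating set of $I_G$ (taken to be $0$ if $I_G=0$). A minor of $G$ is a graph with at least one vertex obtained from $G$ by a sequence of edge contractions and vertex deletions (no edge deletions; multiple edges arising from contraction are merged). *)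

(* Defs.v *)
From mathcomp Require Import all_boot all_order all_algebra.
From mathcomp Require Import classical_sets reals.
From mathcomp Require Import complex.
From mathcomp Require Import mpoly.

Set Implicit Arguments.
Unset Strict Implicit.
Unset Printing Implicit Defensive.

Import GRing.Theory.
Local Open Scope ring_scope.
Local Open Scope classical_set_scope.

Record sgraph (n : nat) := SGraph {
  adj :> rel 'I_n;
  adj_sym : ssrbool.symmetric adj;
  adj_irr : irreflexive adj }.

Definition graph_iso n (G H : sgraph n) : Prop :=
  exists2 s : 'I_n -> 'I_n, bijective s & forall i j, H (s i) (s j) = G i j.

Section DeletionContraction.
Variables (n : nat) (G : sgraph n.+1).

(* Vertex i of the smaller graph stands for the vertex [lift v i] of G. *)
Definition del_adj (v : 'I_n.+1) : rel 'I_n :=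
  fun i j => G (lift v i) (lift v j).

Lemma del_sym v : ssrbool.symmetric (del_adj v).
Proof. by move=> i j; rewrite /del_adj adj_sym. Qed.

Lemma del_irr v : irreflexive (del_adj v).
Proof. by move=> i; rewrite /del_adj adj_irr. Qed.

Definition delete_vertex v := SGraph (del_sym v) (del_irr v).

(* v is merged into u: the index i with [lift v i = u] stands for the merged  *)
(* vertex, whose neighbours are those of u and of v, other than u and v.      *)
Definition contr_adj (u v : 'I_n.+1) : rel 'I_n :=
  fun i j => (i != j) &&
    [|| G (lift v i) (lift v j),
        (lift v i == u) && G v (lift v j) |
        (lift v j == u) && G (lift v i) v].

Lemma contr_sym u v : ssrbool.symmetric (contr_adj u v).
Proof.
move=> i j; rewrite /contr_adj eq_sym (adj_sym G (lift v i) (lift v j)).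
rewrite (adj_sym G v (lift v j)) (adj_sym G (lift v i) v).
by congr (_ && (_ || _)); rewrite orbC.
Qed.

Lemma contr_irr u v : irreflexive (contr_adj u v).
Proof. by move=> i; rewrite /contr_adj eqxx. Qed.

Definition contract_edge u v := SGraph (contr_sym u v) (contr_irr u v).

End DeletionContraction.

(* The isomorphism step accounts for the relabelling of the remaining         *)
(* vertices by 'I_m.                                                          *)
Inductive reduces_to n (G : sgraph n) : forall m, sgraph m -> Prop :=
| reduces_refl : reduces_to G G
| reduces_iso m (H K : sgraph m) :
    reduces_to G H -> graph_iso H K -> reduces_to G K
| reduces_delete m (H : sgraph m.+1) (v : 'I_m.+1) :
    reduces_to G H -> reduces_to G (delete_vertex H v)
| reduces_contract m (H : sgraph m.+1) (u v : 'I_m.+1) :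
    reduces_to G H -> H u v -> reduces_to G (contract_edge H u v).

Definition is_minor m (H : sgraph m) n (G : sgraph n) : Prop :=
  (0 < m)%N /\ reduces_to G H.

Section Ideals.
Variables (N : nat) (K : fieldType).
Implicit Types (S T I : set {mpoly K[N]}) (f : {mpoly K[N]}).

Definition ideal_span S : set {mpoly K[N]} :=
  [set f | exists2 s : seq ({mpoly K[N]} * {mpoly K[N]}),
             (forall x, x \in s -> S x.2) & f = \sum_(x <- s) x.1 * x.2].

Definition minimal_homog_gens I S : Prop :=
  [/\ forall f, S f -> f \is homog mdeg,
      ideal_span S = I
    & forall T, T `<` S -> ideal_span T <> I].

Definition minimal_generator I f : Prop :=
  exists2 S, minimal_homog_gens I S & S f.

End Ideals.

(* The largest element of D, or 0 if there is none. *)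
Definition largest (D : set nat) : nat :=
  xget 0%N [set d | D d /\ forall e, D e -> (e <= d)%N].

Section MarkovWidth.
Variables (K : fieldType) (n : nat) (G : sgraph n).

(* The edge {j, k} is represented by the pair (j, k) with j < k. *)
Definition edge := {e : 'I_n * 'I_n | (e.1 < e.2)%N && G e.1 e.2}.

Definition isolated := {l : 'I_n | [forall k, ~~ G l k]}.

(* An index i_1 ... i_n of the source variables, and (edge, (a, b)) or        *)
(* (isolated vertex, a) for the target variables.  Variables of {mpoly K[N]}  *)
(* being indexed by 'I_N, both types are enumerated by enum_rank.             *)
Definition pvar := {ffun 'I_n -> bool}.
Definition tvar := (edge * (bool * bool) + isolated * bool)%type.

Definition pring := {mpoly K[#|{: pvar}|]}.
Definition tring := {mpoly K[#|{: tvar}|]}.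

Definition t_edge (e : edge) (a b : bool) : tring :=
  'X_(enum_rank (inl (e, (a, b)) : tvar)).

Definition t_iso (l : isolated) (a : bool) : tring :=
  'X_(enum_rank (inr (l, a) : tvar)).

Definition phi_monomial (i : pvar) : tring :=
  (\prod_(e : edge) t_edge e (i (val e).1) (i (val e).2)) *
  \prod_(l : isolated) t_iso l (i (val l)).

Definition phi (f : pring) : tring :=
  f \mPo [tuple phi_monomial (enum_val x) | x < #|{: pvar}|].

Definition toric_ideal : set pring := [set f | phi f = 0].

(* [(msize f).-1] is the degree of f.  The set of degrees is bounded by        *)
(* noetherianity, and empty exactly when the ideal is 0, so the default value *)
(* of [largest] is only used for the zero ideal.                              *)
Definition markov_width : nat :=
  largest [set d | exists2 f, minimal_generator toric_ideal f
                            & d = (msize f).-1].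

End MarkovWidth.

(* Main.v *)
Require Import Defs.
From mathcomp Require Import all_boot all_order all_algebra.
From mathcomp Require Import boolp classical_sets reals complex mpoly.

Set Implicit Arguments.
Unset Strict Implicit.
Unset Printing Implicit Defensive.

Import Order.TTheory GRing.Theory.
Local Open Scope ring_scope.
Local Open Scope classical_set_scope.

(** The width of a toric ideal can be read off without choosing generators: a
    graded ideal has all its minimal generators in degrees at most [D] exactly
    when its elements of degree at most [D] span it
    ([largest_generator_degreeP]).  Hilbert's basis theorem, obtained from
    Dickson's lemma, enters here twice: it provides a minimal set of
    generators, and it bounds the degrees of minimal generators, so that
    [largest] is a true maximum.

    Being spanned in degrees at most [D] passes from an ideal [I] to an ideal
    [J] of another polynomial ring as soon as there are degree-preserving
    substitutions in both directions that map [J] into [I] and [I] into [J] and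
    whose composite from the ring of [J] to itself is the identity: expand the
    image in [I] of an element of [J] and map the expansion back.

    For a graph [H] obtained from [G] by deleting a vertex or contracting an
    edge, such substitutions come from graph theory.  A configuration on [H]
    extends to [G] by giving the two ends of a contracted edge the same value,
    and a deleted vertex the value [false]; a configuration on [G] restricts to
    [H], except that the variable of a configuration taking different values
    at the ends of a contracted edge is sent to 0.  These substitutions respect
    the toric ideals because each of them lifts to a substitution of the
    parameters ([toric_ideal_extend], [toric_ideal_restrict]).  For extensions
    this uses that each vertex of [H] lies on an edge or is isolated: the
    factors of the edges of [G] that have no counterpart in [H] are absorbed by
    a parameter of [H] that sees the same values.  Here [H] must have a vertex,
    as otherwise there is no parameter to absorb anything. *)

(** * Ideals of a polynomial ring *)

Section IdealSpan.
Variables (N : nat) (K : fieldType).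
Implicit Types (S T I : set {mpoly K[N]}) (f g : {mpoly K[N]}).

Definition is_ideal I : Prop :=
  [/\ I 0, forall f g, I f -> I g -> I (f + g) & forall f g, I g -> I (f * g)].

Lemma ideal_sum I (J : eqType) (s : seq J) (F : J -> {mpoly K[N]}) :
  is_ideal I -> (forall j, j \in s -> I (F j)) -> I (\sum_(j <- s) F j).
Proof.
move=> [I0 ID _] IF; rewrite big_seq_cond.
by apply: big_ind => // j /andP[+ _]; apply: IF.
Qed.

Lemma sub_ideal_span S : S `<=` ideal_span S.
Proof.
move=> f Sf; exists [:: (1, f)]; last by rewrite big_seq1 mul1r.
by move=> x; rewrite inE => /eqP ->.
Qed.

Lemma ideal_span_min S I : is_ideal I -> S `<=` I -> ideal_span S `<=` I.
Proof.
move=> idI SI _ [s Ss ->]; apply: ideal_sum => // x /Ss Sx.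
by case: idI => _ _; apply; apply: SI.
Qed.

Lemma ideal_span_is_ideal S : is_ideal (ideal_span S).
Proof.
split=> [|_ _ [s Ss ->] [t St ->]|f _ [s Ss ->]].
- by exists [::]; rewrite ?big_nil.
- exists (s ++ t); last by rewrite big_cat.
  by move=> x; rewrite mem_cat => /orP[/Ss|/St].
exists [seq (f * x.1, x.2) | x <- s]; first by move=> _ /mapP[x /Ss ? ->].
by rewrite big_map mulr_sumr; apply: eq_bigr => x _; rewrite mulrA.
Qed.

Lemma ideal_spanS S T : S `<=` T -> ideal_span S `<=` ideal_span T.
Proof.
move=> ST; apply: ideal_span_min; first exact: ideal_span_is_ideal.
by move=> f /ST; apply: sub_ideal_span.
Qed.

End IdealSpan.

(** * Finite generation *)

(** Dickson's lemma.  Induction on the number of weights: a basis [s] for the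
    first [k] weights takes care of every [a] whose last weight is at least
    the largest last weight [M] occurring in [s], and the elements with last
    weight [h] have their own basis for each of the finitely many [h < M]. *)
Lemma dickson (T : eqType) (w : nat -> T -> nat) k (A : set T) :
  exists2 s : seq T, (forall b, b \in s -> A b) &
    forall a, A a ->
      exists2 b, b \in s & forall i, (i < k)%N -> (w i b <= w i a)%N.
Proof.
elim: k A => [|k IHk] A.
  have [[a Aa]|noA] := pselect (exists a, A a).
    exists [:: a] => [b|b _]; first by rewrite inE => /eqP ->.
    by exists a; rewrite ?mem_head.
  by exists [::] => // a Aa; case: noA; exists a.
have [s sA sP] := IHk A; pose M := (\max_(b <- s) w k b)%N.
have [t tA tP] : exists2 t : seq T, (forall b, b \in t -> A b) &
    forall a, A a -> (w k a < M)%N ->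
    exists2 b, b \in t & forall i, (i < k.+1)%N -> (w i b <= w i a)%N.
  elim: M => [|M [t tA tP]]; first by exists [::].
  have [u uA uP] := IHk [set a | A a /\ w k a = M].
  exists (t ++ u) => [b|a Aa].
    by rewrite mem_cat => /orP[/tA|/uA[]].
  rewrite ltnS leq_eqVlt => /predU1P[wa|/(tP _ Aa)[b bt bP]].
    have [|b bu bP] := uP a; first by [].
    exists b => [|i]; first by rewrite mem_cat bu orbT.
    rewrite ltnS leq_eqVlt => /predU1P[->|/bP //].
    by have [_ ->] := uA b bu; rewrite wa.
  by exists b => //; rewrite mem_cat bt.
exists (s ++ t) => [b|a Aa]; first by rewrite mem_cat => /orP[/sA|/tA].
have [/(tP _ Aa)[b bt bP]|leMa] := ltnP (w k a) M.
  by exists b => //; rewrite mem_cat bt orbT.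
have [b bs bP] := sP a Aa; exists b => [|i]; first by rewrite mem_cat bs.
rewrite ltnS leq_eqVlt => /predU1P[->|/bP //].
by apply: leq_trans leMa; apply: leq_bigmax_seq.
Qed.

Section Hilbert.
Variables (N : nat) (K : fieldType).
Implicit Types (S T I : set {mpoly K[N]}) (f g : {mpoly K[N]}).

(** Hilbert's basis theorem.  By Dickson's lemma finitely many nonzero
    elements of the ideal have leading monomials dividing all the others, and
    subtracting a monomial multiple of one of them lowers the leading monomial
    of any other element. *)
Lemma ideal_fin_gen I : is_ideal I ->
  exists2 s : seq {mpoly K[N]}, (forall g, g \in s -> I g) &
    I `<=` ideal_span [set` s].
Proof.
move=> idI; have [I0 ID IM] := idI.
have IB f g : I f -> I g -> I (f - g).
  by move=> If Ig; rewrite -mulN1r; apply: ID => //; apply: IM.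
pose w i f := nth 0%N (mlead f) i.
have [s sI sP] := dickson w N [set f | I f /\ f != 0].
exists s => [g /sI[]//|f].
elim/mleadrect: f => f IHf If.
have [J0 JD JM] := ideal_span_is_ideal [set` s].
have [->|nz_f] := eqVneq f 0; first exact: J0.
have [//|b bs bP] := sP f; have [Ib nz_b] := sI b bs.
have le_bf : (mlead b <= mlead f)%MM.
  apply/mnm_lepP => i; have := bP i (ltn_ord i).
  by rewrite /w -!mnm_nth.
pose c := mleadc f / mleadc b *: 'X_[mlead f - mlead b] * b.
have nz_c : mleadc f / mleadc b != 0.
  by rewrite mulf_neq0 ?invr_eq0 // mleadc_eq0.
have Jc : ideal_span [set` s] c by apply: JM; apply: sub_ideal_span.
have lead_c : mlead c = mlead f.
  rewrite /c mleadM ?mleadZ ?mleadXm ?submK //.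
  rewrite scaler_eq0 negb_or nz_c; apply/eqP.
  move=> /(congr1 (mcoeff (mlead f - mlead b))); rewrite mcoeffX eqxx mcoeff0.
  by apply/eqP; rewrite oner_eq0.
have coef_c : c@_(mlead f) = mleadc f.
  rewrite /c -scalerAl mcoeffZ -{2}(submK le_bf).
  rewrite -{1}(mleadXm K (mlead f - mlead b)).
  by rewrite mleadcM mleadXm mcoeffX eqxx mul1r divfK // mleadc_eq0.
rewrite -(subrK c f); apply: JD => //.
have [->|nz_fc] := eqVneq (f - c) 0; first exact: J0.
apply: IHf; last by apply: IB => //; apply: IM.
have : (mlead (f - c) <= mlead f)%O.
  by have := mleadB_le f c; rewrite lead_c joinxx.
rewrite le_eqVlt => /predU1P[eq_fc|//].
by move: nz_fc; rewrite -mleadc_eq0 eq_fc mcoeffB coef_c subrr eqxx.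
Qed.

End Hilbert.

(** * Degrees of minimal generators *)

Section Degrees.
Variables (N : nat) (K : fieldType).
Implicit Types (S T I : set {mpoly K[N]}) (f g : {mpoly K[N]}).

Definition graded I := forall f d, I f -> I (pihomog mdeg d f).

Definition low_degree I D : set {mpoly K[N]} :=
  [set h | I h /\ exists2 e, (e <= D)%N & h \is e.-homog].

Definition gen_in_degree I D := I `<=` ideal_span (low_degree I D).

Lemma dhomog_msizeE f e : f != 0 -> f \is e.-homog -> (msize f).-1 = e.
Proof.
by move=> nz_f hf; exact: (dhomog_uniq nz_f (dhomog_msize hf) hf).
Qed.

(** Comparing components of degree [e] in a combination of elements of [S],
    only the elements of [S] of degree at most [e] contribute. *)
Lemma span_low_degree S f e :
  (forall g, S g -> g \is homog mdeg) -> f \is e.-homog -> ideal_span S f ->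
  ideal_span (low_degree S e) f.
Proof.
move=> hS hf [s Ss def_f]; have idJ := ideal_span_is_ideal (low_degree S e).
rewrite -(pihomog_dE hf) def_f raddf_sum /=.
apply: ideal_sum => // x /Ss Sx; have [d hd] := homogP _ _ (hS _ Sx).
rewrite {1}(pihomog_partitionE (leqnn (msize x.1))) mulr_suml raddf_sum /=.
apply: ideal_sum => // i _; have hM := dhomogM (pihomogP mdeg i x.1) hd.
have [eq_e|ne_e] := eqVneq (i + d)%N e; last first.
  by rewrite (pihomog_ne0 ne_e hM); case: idJ.
rewrite eq_e in hM; rewrite (pihomog_dE hM); case: idJ => _ _; apply.
by apply: sub_ideal_span; split=> //; exists d; rewrite // -eq_e leq_addl.
Qed.

(** If [f] had degree above [D], the elements of degree at most [D] would be
    combinations of members of the generating set of degree at most [D], hence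
    other than [f], and [f] would be superfluous. *)
Lemma minimal_generator_low_degree I D f :
  gen_in_degree I D -> minimal_generator I f -> ((msize f).-1 <= D)%N.
Proof.
move=> genI [S [hS spanS minS] Sf]; rewrite leqNgt; apply/negP=> lt_D.
pose T := S `\ f; have TS : T `<=` S by move=> g [].
apply: (minS T); first by split=> // ST; have [_] := ST _ Sf; apply.
rewrite eqEsubset; split; first by rewrite -spanS; apply: ideal_spanS.
move=> g /genI; apply: ideal_span_min; first exact: ideal_span_is_ideal.
move=> h [Ih [e le_e hh]]; rewrite -spanS in Ih.
apply: ideal_spanS (span_low_degree hS hh Ih) => u [Su [d le_d hu]].
split=> //= def_u; have [u0|nz_u] := eqVneq u 0.
  by rewrite -def_u u0 msize0 in lt_D.
move: lt_D; rewrite -def_u (dhomog_msizeE nz_u hu) ltnNge.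
by rewrite (leq_trans le_d).
Qed.

Lemma graded_fin_homog_gen I : is_ideal I -> graded I ->
  exists2 s : seq {mpoly K[N]}, (forall g, g \in s -> g \is homog mdeg) &
    ideal_span [set` s] = I.
Proof.
move=> idI grI; have [s sI genI] := ideal_fin_gen idI.
exists [seq pihomog mdeg d g | g <- s, d <- iota 0 (msize g)].
  move=> _ /allpairsPdep[g [d [_ _ ->]]]; apply/homogP; exists d.
  exact: pihomogP.
rewrite eqEsubset; split.
  apply: ideal_span_min => // _ /allpairsPdep[g [d [gs _ ->]]].
  by apply: grI; apply: sI.
move=> f /genI; apply: ideal_span_min; first exact: ideal_span_is_ideal.
move=> g gs; rewrite (pihomog_partitionE (leqnn (msize g))).
apply: ideal_sum; first exact: ideal_span_is_ideal.
move=> i _; apply: sub_ideal_span; apply/allpairsPdep.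
by exists g, (val i); split; rewrite // mem_iota /=.
Qed.

(** Discarding superfluous elements from a finite generating set terminates in
    a minimal one. *)
Lemma minimal_homog_gens_exists I : is_ideal I -> graded I ->
  exists S, minimal_homog_gens I S.
Proof.
move=> idI grI; have [s hs spans] := graded_fin_homog_gen idI grI.
have [k] := ubnP (size s); elim: k => // k IHk in s hs spans *.
rewrite ltnS => le_k.
have [minS|] := pselect (forall T, T `<` [set` s] -> ideal_span T <> I).
  by exists [set` s].
rewrite -existsNE => -[T /not_implyP[[Ts /existsNP[x /not_implyP[xs Tx]]]]].
move=> /contrapT spanT; apply: (IHk [seq y <- s | y != x]).
- by move=> g; rewrite mem_filter => /andP[_ /hs].
- rewrite eqEsubset; split.
    rewrite -spans; apply: ideal_spanS => g /=.
    by rewrite mem_filter => /andP[].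
  rewrite -spanT; apply: ideal_spanS => g Tg /=.
  rewrite mem_filter; apply/andP; split; last exact: Ts.
  by apply/eqP=> def_g; rewrite def_g in Tg.
apply: leq_trans le_k; rewrite size_filter -(count_predC (pred1 x) s).
by rewrite -[X in (X < _)%N]add0n ltn_add2r -has_count has_pred1.
Qed.

Lemma largest_is_max (A : set nat) B d :
  (forall e, A e -> (e <= B)%N) -> A d ->
  A (largest A) /\ (forall e, A e -> (e <= largest A)%N).
Proof.
move=> leB Ad; rewrite /largest.
have [m [Am mP]] : exists m, A m /\ forall e, A e -> (e <= m)%N.
  have exA : exists n, `[<A n>] by exists d; apply/asboolP.
  have ubA n : `[<A n>] -> (n <= B)%N by move/asboolP; apply: leB.
  case: (ex_maxnP exA ubA) => m /asboolP Am mP; exists m; split=> // e Ae.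
  by apply: mP; apply/asboolP.
exact: (@xgetPex _ 0%N [set d | A d /\ forall e, A e -> (e <= d)%N]
          (ex_intro _ m (conj Am mP))).
Qed.

Lemma largest_set0 : largest set0 = 0%N.
Proof. by rewrite /largest; case: xgetP => // d _ [[]]. Qed.

(** The left-hand side speaks of all minimal generators, the right-hand side of
    no generating set at all.  From left to right, the minimal generating set
    that is known to exist lies in degrees at most [D]; [largest] does bound
    the degrees there, because finitely many generators give a bound [B] for
    which [minimal_generator_low_degree] applies. *)
Lemma largest_generator_degreeP I D : is_ideal I -> graded I ->
  (largest [set d | exists2 f, minimal_generator I f & d = (msize f).-1] <= D)%N
    <-> gen_in_degree I D.
Proof.
move=> idI grI.
set A := (X in largest X).
have boundA e : gen_in_degree I e -> forall d, A d -> (d <= e)%N.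
  by move=> geni d [f mf ->]; apply: minimal_generator_low_degree mf.
split=> [le_D|genI]; last first.
  have [[d Ad]|noA] := pselect (exists d, A d); last first.
    suff -> : A = set0 by rewrite largest_set0.
    by rewrite -subset0 => d Ad; apply: noA; exists d.
  have [Am _] := largest_is_max (boundA _ genI) Ad.
  exact: boundA genI _ Am.
have [s hs spans] := graded_fin_homog_gen idI grI.
have genB : gen_in_degree I (\max_(g <- s) (msize g).-1)%N.
  move=> f; rewrite -{1}spans; apply: ideal_spanS => g gs; split.
    by rewrite -spans; apply: sub_ideal_span.
  exists (msize g).-1.
    by apply: (leq_bigmax_seq (F := fun g => (msize g).-1)).
  by have [d hd] := homogP _ _ (hs _ gs); apply: dhomog_msize hd.
have [S mS] := minimal_homog_gens_exists idI grI.
have [hS spanS _] := mS.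
move=> f; rewrite -{1}spanS; apply: ideal_spanS => g Sg; split.
  by rewrite -spanS; apply: sub_ideal_span.
have Ag : A (msize g).-1 by exists g => //; exists S.
exists (msize g).-1; last first.
  by have [d hd] := homogP _ _ (hS _ Sg); apply: dhomog_msize hd.
have [_ /(_ _ Ag) le_g] := largest_is_max (boundA _ genB) Ag.
exact: leq_trans le_g le_D.
Qed.

End Degrees.

(** * Substitutions *)

Section Substitution.
Variables (K : fieldType) (T : finType).
Implicit Types (M : nat) (f : {mpoly K[#|T|]}).

Definition substX M (s : T -> {mpoly K[M]}) f : {mpoly K[M]} :=
  f \mPo [tuple s (enum_val x) | x < #|T|].

Lemma substX_var M (s : T -> {mpoly K[M]}) x : substX s 'X_(enum_rank x) = s x.
Proof. by rewrite /substX comp_mpolyXU -tnth_nth tnth_mktuple enum_rankK. Qed.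

Lemma substX0 M (s : T -> {mpoly K[M]}) : substX s 0 = 0.
Proof. exact: raddf0. Qed.

Lemma substXD M (s : T -> {mpoly K[M]}) : {morph substX s : f g / f + g}.
Proof. exact: raddfD. Qed.

Lemma substXM M (s : T -> {mpoly K[M]}) : {morph substX s : f g / f * g}.
Proof. exact: rmorphM. Qed.

Lemma substX_prod M (s : T -> {mpoly K[M]}) (J : finType) F :
  substX s (\prod_(j : J) F j) = \prod_(j : J) substX s (F j).
Proof. exact: rmorph_prod. Qed.

Lemma substX_sum M (s : T -> {mpoly K[M]}) (J : finType) F :
  substX s (\sum_(j : J) F j) = \sum_(j : J) substX s (F j).
Proof. exact: raddf_sum. Qed.

Lemma eq_substX M (s t : T -> {mpoly K[M]}) : s =1 t -> substX s =1 substX t.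
Proof.
by move=> st f; congr comp_mpoly; apply: eq_mktuple => x; apply: st.
Qed.

Lemma substX_id f : substX (fun x => 'X_(enum_rank x)) f = f.
Proof.
rewrite -[RHS]comp_mpoly_id; congr comp_mpoly.
by apply: eq_mktuple => x; rewrite enum_valK.
Qed.

Lemma substX_dhomog M (s : T -> {mpoly K[M]}) D f d :
  (forall x, s x \is D.-homog) -> f \is d.-homog ->
  substX s f \is (d * D).-homog.
Proof.
move=> hs /dhomogP hf; rewrite /substX comp_mpolyEX big_seq.
apply: rpred_sum => m /hf /= <-; apply: rpredZ; rewrite comp_mpolyX.
rewrite mdegE; elim/big_rec2: _ => [|i y1 y2 _ IH]; first exact: dhomog1.
rewrite mulnDl; apply: dhomogM IH; rewrite tnth_mktuple mulnC.
exact: dhomogMn.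
Qed.

End Substitution.

Lemma substX_comp (K : fieldType) (T U : finType) M
    (s : T -> {mpoly K[#|U|]}) (t : U -> {mpoly K[M]}) f :
  substX t (substX s f) = substX (fun x => substX t (s x)) f.
Proof.
rewrite [RHS]comp_mpolyEX [substX s f]comp_mpolyEX /substX raddf_sum /=.
apply: eq_bigr => m _; rewrite linearZ /= !comp_mpolyX rmorph_prod /=.
by congr (_ *: _); apply: eq_bigr => i _; rewrite rmorphXn /= !tnth_mktuple.
Qed.

(** * The parametrization by blocks *)

Section Blocks.
Variables (K : fieldType) (n : nat) (G : sgraph n).

(** The factors of [phi_monomial] are indexed by the edges and the isolated
    vertices alike; an isolated vertex counts as a degenerate edge. *)
Definition block := (edge G + isolated G)%type.

Definition ends (c : block) : 'I_n * 'I_n :=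
  match c with inl e => val e | inr l => (val l, val l) end.

Definition on_block (c : block) : pred 'I_n :=
  fun i => (i == (ends c).1) || (i == (ends c).2).

Definition labels (c : block) (x : pvar n) : bool * bool :=
  (x (ends c).1, x (ends c).2).

Definition param (c : block) (ab : bool * bool) : tring K G :=
  match c with
  | inl e => t_edge K e ab.1 ab.2
  | inr l => t_iso K l ab.1
  end.

Lemma phi_monomialE x : phi_monomial K G x = \prod_c param c (labels c x).
Proof. by rewrite /phi_monomial big_sumType. Qed.

Lemma phi_var x : phi G ('X_(enum_rank x) : pring K n) = phi_monomial K G x.
Proof. exact: substX_var. Qed.

Lemma toric_ideal_is_ideal : is_ideal (@toric_ideal K _ G).
Proof.
rewrite /toric_ideal; split=> [|f g|f g] /=; first exact: substX0.
- by move=> f0 g0; rewrite [LHS]substXD [X in X + _]f0 [X in _ + X]g0 addr0.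
by move=> g0; rewrite [LHS]substXM [X in _ * X]g0 mulr0.
Qed.

Lemma prod_dhomog M (J : finType) (F : J -> {mpoly K[M]}) :
  (forall j, F j \is 1.-homog) -> \prod_j F j \is #|J|.-homog.
Proof.
move=> hF; rewrite -sum1_card.
apply: (big_rec2 (fun (d : nat) (p : {mpoly K[M]}) => p \is d.-homog)).
  exact: dhomog1.
by move=> j d p _ hp; apply: dhomogM.
Qed.

Lemma phi_monomial_dhomog x : phi_monomial K G x \is #|{: block}|.-homog.
Proof.
rewrite phi_monomialE; apply: prod_dhomog => -[e|l].
  by rewrite dhomogX /= mdeg1.
by rewrite dhomogX /= mdeg1.
Qed.

Lemma block_adj i j : G i j -> exists c, on_block c i /\ on_block c j.
Proof.
move=> Gij; have [lt_ij|lt_ji|eq_ij] := ltngtP i j; last 1 first.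
- by move: Gij; rewrite (val_inj eq_ij) adj_irr.
- have Ge : ((i, j).1 < (i, j).2)%N && G (i, j).1 (i, j).2 by rewrite lt_ij.
  by exists (inl (exist _ (i, j) Ge)); rewrite /on_block /= !eqxx orbT.
have Ge : ((j, i).1 < (j, i).2)%N && G (j, i).1 (j, i).2.
  by rewrite lt_ji adj_sym.
by exists (inl (exist _ (j, i) Ge)); rewrite /on_block /= !eqxx orbT.
Qed.

Lemma block_cover i : exists c, on_block c i.
Proof.
have [isol|] := boolP [forall k, ~~ G i k].
  by exists (inr (exist _ i isol)); rewrite /on_block /= eqxx.
rewrite negb_forall => /existsP[k]; rewrite negbK => /block_adj[c [ci _]].
by exists c.
Qed.

Lemma block_ends c i j : on_block c i -> on_block c j -> i = j \/ G i j.
Proof.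
case: c => [[[a b] ab]|[l ?]]; last first.
  by rewrite /on_block /= => /orP[]/eqP-> /orP[]/eqP->; left.
have /andP[_ /= Gab] := ab.
rewrite /on_block /=; move=> /orP[]/eqP-> /orP[]/eqP->; try by left.
  by right.
by right; rewrite adj_sym.
Qed.

Lemma block_two_ends c i j k : i != j ->
  on_block c i -> on_block c j -> on_block c k -> k = i \/ k = j.
Proof.
rewrite /on_block => ne_ij /orP[]/eqP ei /orP[]/eqP ej /orP[]/eqP ->;
  rewrite -?ei -?ej; try (by left); try (by right).
  by rewrite ei ej eqxx in ne_ij.
by rewrite ei ej eqxx in ne_ij.
Qed.

(** All [phi_monomial]s have the same degree, positive as soon as there is a
    vertex, so distinct homogeneous components of a polynomial have images of
    distinct degrees. *)
Lemma toric_ideal_graded : (0 < n)%N -> graded (@toric_ideal K _ G).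
Proof.
move=> n_gt0 f d f0; have [c _] := block_cover (Ordinal n_gt0).
have D_gt0 : (0 < #|{: block}|)%N by apply/card_gt0P; exists c.
have hom e : substX (phi_monomial K G) (pihomog mdeg e f)
    \is (e * #|{: block}|)%N.-homog.
  by apply: substX_dhomog (pihomogP _ _ _); apply: phi_monomial_dhomog.
have [lt_d|le_d] := ltnP d (msize f); last first.
  suff -> : pihomog mdeg d f = 0 by case: toric_ideal_is_ideal.
  rewrite pihomogE big_seq_cond big1 // => m /andP[/msize_mdeg_lt lt_m /eqP md].
  by move: lt_m; rewrite md ltnNge le_d.
have phiE : phi G f = \sum_(e < msize f) phi G (pihomog mdeg e f).
  rewrite {1}(pihomog_partitionE (leqnn (msize f))); exact: substX_sum.
have := congr1 (pihomog mdeg (d * #|{: block}|)) f0.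
rewrite phiE raddf0 raddf_sum /= (bigD1 (Ordinal lt_d)) //=.
rewrite (pihomog_dE (hom d)) big1 ?addr0 // => e ne_ed.
by apply: pihomog_ne0 (hom e); rewrite eqn_pmul2r.
Qed.

End Blocks.

(** If [t] is a substitution of the parameters matching the substitution [s] of
    the [p]-variables, the two ways from [pring K n] to [tring K H] agree, and
    what [phi G] kills is killed by [phi H] after [s].  The label [(a, a)] is
    the only shape of label that an isolated vertex receives. *)
Lemma toric_ideal_subst (K : fieldType) n m (G : sgraph n) (H : sgraph m)
    (s : pvar n -> pring K m) (t : block G -> bool * bool -> tring K H) :
  (forall x, \prod_c t c (labels c x) = phi H (s x)) ->
  forall f, toric_ideal G f -> toric_ideal H (substX s f).
Proof.
move=> ts f f0; rewrite /toric_ideal /=.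
pose t' (z : tvar G) : tring K H :=
  match z with inl (e, ab) => t (inl e) ab | inr (l, a) => t (inr l) (a, a) end.
rewrite [LHS]substX_comp.
rewrite (@eq_substX _ _ _ _ (fun x => substX t' (phi_monomial K G x))).
  by rewrite -substX_comp [X in substX _ X]f0 substX0.
move=> x; rewrite -[LHS]ts phi_monomialE substX_prod.
apply: eq_bigr => -[e|l] _.
  by rewrite [RHS]substX_var.
by rewrite [RHS]substX_var.
Qed.

(** * Retractions of graphs *)

(** The common pattern of relabelling, deletion and contraction.  Here [a]
    folds [G] onto [H], with value [None] at a deleted vertex, and [b] chooses
    a representative in each class of merged vertices.  The classes are stars
    around their representatives, so that a configuration that is not constant
    on some class already differs at the two ends of an edge of [G]. *)
Definition retraction n m (G : sgraph n) (H : sgraph m)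
    (a : 'I_n -> option 'I_m) (b : 'I_m -> 'I_n) : Prop :=
  [/\ forall j, a (b j) = Some j,
      forall i i' j j', G i i' -> a i = Some j -> a i' = Some j' ->
        j = j' \/ H j j',
      forall j j', H j j' ->
        exists i i', [/\ G i i', a i = Some j & a i' = Some j']
    & forall i j, a i = Some j -> i = b j \/ G i (b j)].

Section Retraction.
Variables (K : fieldType) (n m : nat) (G : sgraph n) (H : sgraph m).
Variables (a : 'I_n -> option 'I_m) (b : 'I_m -> 'I_n).
Hypotheses (m_gt0 : (0 < m)%N) (rGH : retraction G H a b).

Definition extend (y : pvar m) : pvar n :=
  [ffun i => if a i is Some j then y j else false].

Definition restrict (x : pvar n) : pvar m := [ffun j => x (b j)].

Definition constant_on_classes (x : pvar n) : bool :=
  [forall i, forall j, (a i == Some j) ==> (x i == x (b j))].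

Definition extend_var (y : pvar m) : pring K n := 'X_(enum_rank (extend y)).

Definition restrict_var (x : pvar n) : pring K m :=
  if constant_on_classes x then 'X_(enum_rank (restrict x)) else 0.

Lemma constant_on_classesP (x : pvar n) :
  reflect (forall i j, a i = Some j -> x i = x (b j)) (constant_on_classes x).
Proof.
apply: (iffP forallP) => [cx i j aij|cx i].
  by have /forallP/(_ j) := cx i; rewrite aij eqxx => /eqP.
by apply/forallP => j; apply/implyP => /eqP/cx ->.
Qed.

Lemma restrict_extend_var y :
  substX restrict_var (extend_var y) = 'X_(enum_rank y).
Proof.
have [ab _ _ _] := rGH; rewrite substX_var /restrict_var.
have -> : constant_on_classes (extend y).
  by apply/constant_on_classesP => i j aij; rewrite !ffunE aij ab.
by congr 'X_(enum_rank _); apply/ffunP => j; rewrite !ffunE ab.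
Qed.

(** At most two vertices of [H] are images of ends of [c], and if there are two
    then they are adjacent.  If both ends of [c] are discarded, any block of
    [H] will do, and [m_gt0] ensures that there is one. *)
Lemma block_image (c : block G) :
  exists d : block H, forall i j, on_block c i -> a i = Some j -> on_block d j.
Proof.
have [_ aG _ _] := rGH.
have [[i [j [ci aij]]]|none] :=
  pselect (exists i j, on_block c i /\ a i = Some j).
  have [[i' [j' [[ci' aij'] ne_j]]]|same] :=
    pselect (exists i' j', (on_block c i' /\ a i' = Some j') /\ j != j').
    have Gii' : G i i'.
      have [def_i|//] := block_ends ci ci'.
      by case/eqP: ne_j; move: aij'; rewrite -def_i aij => -[].
    have Hjj' : H j j'.
      by have [eq_j|//] := aG _ _ _ _ Gii' aij aij'; rewrite eq_j eqxx in ne_j.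
    have [d [dj dj']] := block_adj Hjj'; exists d => k l ck akl.
    have ne_i : i != i'.
      apply: contraNneq ne_j => eq_i; rewrite eq_i aij' in aij.
      by case: aij => ->.
    by case: (block_two_ends ne_i ci ci' ck) akl => ->;
      rewrite ?aij ?aij' => -[<-].
  have [d dj] := block_cover H j; exists d => k l ck akl.
  have [<- //|ne_l] := eqVneq j l.
  by case: same; exists k, l.
have [d _] := block_cover H (Ordinal m_gt0); exists d => i j ci aij.
by case: none; exists i, j.
Qed.

(** An edge of [H] lifts to an edge of [G]; for an isolated vertex of [H] any
    block at its representative will do. *)
Lemma block_lift (d : block H) :
  exists c : block G,
    forall j, on_block d j -> exists2 i, on_block c i & a i = Some j.
Proof.
have [ab _ liftH _] := rGH; have [d1 d2] :
  on_block d (ends d).1 /\ on_block d (ends d).2.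
  by rewrite /on_block !eqxx orbT.
have [eq_d|/liftH[i [i' [Gii' ai ai']]]] := block_ends d1 d2.
  have [c cb] := block_cover G (b (ends d).1); exists c => j.
  rewrite /on_block -eq_d orbb => /eqP->.
  by exists (b (ends d).1).
have [c [ci ci']] := block_adj Gii'; exists c => j /orP[]/eqP->.
  by exists i.
by exists i'.
Qed.

(** Each block [c] of [G] is charged to a block [d] of [H] containing the
    images of its ends, so that its labels under [extend y] depend only on the
    labels of [d] under [y]; a parameter of [d] then goes to the product of
    the parameters of the blocks charged to it. *)
Lemma toric_ideal_extend f :
  toric_ideal H f -> toric_ideal G (substX extend_var f).
Proof.
have [s sP] := choice block_image.
pose label (d : block H) (uv : bool * bool) i :=
  if a i is Some j then if j == (ends d).1 then uv.1 else uv.2 else false.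
pose t d uv : tring K G :=
  \prod_(c : block G | s c == d)
    param K c (label d uv (ends c).1, label d uv (ends c).2).
apply: (toric_ideal_subst (t := t)) => y.
rewrite phi_var phi_monomialE (partition_big s xpredT) //=.
apply: eq_bigr => d _; apply: eq_bigr => c /eqP sc.
have labelE i : on_block c i -> label d (labels d y) i = extend y i.
  move=> ci; rewrite /label /extend ffunE.
  case aij: (a i) => [j|//]; have := sP c i j ci aij; rewrite sc.
  by case: eqP => [-> //|ne_j] /orP[/eqP|/eqP->].
by rewrite /labels !labelE // /on_block eqxx ?orbT.
Qed.

(** A parameter of a block [c] of [G] goes to the product of the parameters of
    the blocks of [H] lifted to [c], or to 0 if its labels differ while [c] is
    collapsed.  A configuration [x] that is not constant on classes is
    detected by such a block, joining a vertex to its representative. *)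
Lemma toric_ideal_restrict f :
  toric_ideal G f -> toric_ideal H (substX restrict_var f).
Proof.
have [ab _ _ rep] := rGH; have [s sP] := choice block_lift.
pose torn (c : block G) (uv : bool * bool) :=
  [&& a (ends c).1 == a (ends c).2, a (ends c).1 != None & uv.1 != uv.2].
pose label (c : block G) (uv : bool * bool) j :=
  if a (ends c).1 == Some j then uv.1 else uv.2.
pose t c uv : tring K H := if torn c uv then 0 else
  \prod_(d : block H | s d == c)
    param K d (label c uv (ends d).1, label c uv (ends d).2).
apply: (toric_ideal_subst (t := t)) => x; rewrite /restrict_var.
have [/constant_on_classesP cx|ncx] := boolP (constant_on_classes x).
  rewrite phi_var phi_monomialE (partition_big s xpredT) //=.
  apply: eq_bigr => c _; rewrite /t ifN; last first.
    apply/and3P => -[/eqP eq_a]; case ac: (a _) => [j|//] _ /=.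
    by rewrite (cx _ j ac) (cx _ j) ?eqxx // -eq_a.
  apply: eq_bigr => d /eqP sd.
  have labelE j : on_block d j -> label c (labels c x) j = restrict x j.
    move=> dj; rewrite /label ffunE /=; case: eqP => [/cx //|ne_a].
    have [i ci /[dup] ai /cx <-] := sP d j dj; rewrite sd in ci.
    by case/orP: ci ai => /eqP->.
  by rewrite /labels !labelE // /on_block eqxx ?orbT.
rewrite [RHS]substX0.
have [i [j [aij ne_x]]] : exists i j, a i = Some j /\ x i != x (b j).
  apply: contrapT => none; move/constant_on_classesP: ncx; apply=> i j aij.
  by apply: contra_notP none => /eqP ne_x; exists i, j.
have [eq_i|Gib] := rep i j aij; first by rewrite eq_i eqxx in ne_x.
have [c [ci cb]] := block_adj Gib.
rewrite (bigD1 c) //= /t ifT ?mul0r //.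
have abj := ab j; move: ci cb ne_x aij abj.
rewrite /torn /labels /=.
move=> /orP[]/eqP-> /orP[]/eqP->; rewrite ?eqxx // => ne_x -> ->;
  rewrite eqxx //=.
by rewrite eq_sym.
Qed.

(** The two substitutions make the polynomial ring of [H] a retract of that of
    [G], compatibly with the toric ideals: extend, expand in the generators,
    restrict. *)
Lemma gen_in_degree_retract D :
  gen_in_degree (@toric_ideal K _ G) D -> gen_in_degree (@toric_ideal K _ H) D.
Proof.
move=> genG f /toric_ideal_extend /genG.
have [J0 JD JM] := ideal_span_is_ideal (low_degree (@toric_ideal K _ H) D).
pose J : set (pring K n) := [set g |
  ideal_span (low_degree (@toric_ideal K _ H) D) (substX restrict_var g)].
have idJ : is_ideal J.
  rewrite /J; split=> [|g h|g h] /=; first by rewrite substX0.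
  - by rewrite substXD; apply: JD.
  by rewrite substXM; apply: JM.
have retract g : substX restrict_var (substX extend_var g) = g.
  by rewrite substX_comp (eq_substX restrict_extend_var) substX_id.
rewrite -[X in _ -> _ X]retract; apply: (ideal_span_min idJ).
move=> g [/toric_ideal_restrict Ig [e le_e hg]].
apply: sub_ideal_span; split=> //; exists e => //; rewrite -[e]muln1.
apply: substX_dhomog hg => x; rewrite /restrict_var.
by case: ifP => _; rewrite ?dhomog0 // dhomogX /= mdeg1.
Qed.

End Retraction.

(** * Minors *)

Lemma graph_iso_retraction n (G H : sgraph n) :
  graph_iso G H -> exists a b, retraction G H a b.
Proof.
move=> [s [s' sK s'K] sH]; exists (fun i => Some (s i)), s'; split.
- by move=> j; rewrite s'K.
- by move=> i i' j j' Gii' [<-] [<-]; right; rewrite sH.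
- by move=> j j' Hjj'; exists (s' j), (s' j'); rewrite -sH !s'K.
by move=> i j [<-]; left; rewrite sK.
Qed.

Lemma delete_vertex_retraction n (G : sgraph n.+1) v :
  retraction G (delete_vertex G v) (unlift v) (lift v).
Proof.
have unliftE i j : unlift v i = Some j -> i = lift v j.
  by case: unliftP => // k -> [->].
split=> [j|i i' j j' Gii'|j j' Gjj'|i j /unliftE ->]; last by left.
- by rewrite liftK.
- move=> /unliftE def_i /unliftE def_i'; right.
  by rewrite /= /del_adj -def_i -def_i'.
by exists (lift v j), (lift v j'); rewrite !liftK.
Qed.

(** The only class with two elements consists of [u] and [v], so [v] goes where
    [u] goes, and [u] represents both. *)
Lemma contract_edge_retraction n (G : sgraph n.+1) u v : G u v ->
  retraction G (contract_edge G u v)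
    (fun i => unlift v (if i == v then u else i)) (lift v).
Proof.
move=> Guv; have unliftE i j : unlift v i = Some j -> i = lift v j.
  by case: unliftP => // k -> [->].
have ne_uv : u != v by apply: contraTneq Guv => ->; rewrite adj_irr.
have Gvu : G v u by rewrite adj_sym.
have ne_v k : (lift v k == v) = false by rewrite eq_sym (negPf (neq_lift _ _)).
split=> [j|i i' j j'|j j'|i j].
- by rewrite ne_v liftK.
- move=> Gii' /unliftE def_j /unliftE def_j'.
  have [->|ne_j] := eqVneq j j'; [by left|right].
  rewrite /= /contr_adj ne_j -def_j -def_j' /=.
  move: Gii'; case: ifPn => [/eqP->|_]; case: ifPn => [/eqP->|_];
    rewrite ?adj_irr //.
  + by move=> ->; rewrite eqxx orbT.
  + by move=> ->; rewrite eqxx !orbT.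
  by move=> ->.
- rewrite /= /contr_adj.
  move=> /andP[_ /or3P[Gjj'|/andP[/eqP ju Gv]|/andP[/eqP ju Gv]]].
  + by exists (lift v j), (lift v j'); rewrite !ne_v !liftK.
  + by exists v, (lift v j'); rewrite eqxx ne_v -ju !liftK.
  by exists (lift v j), v; rewrite eqxx ne_v -ju !liftK.
by case: ifPn => [/eqP->|_] /unliftE <-; [right|left].
Qed.

(** Vertex numbers only decrease along a reduction, so the condition [0 < m]
    at its end holds throughout, as [gen_in_degree_retract] demands. *)
Lemma gen_in_degree_reduces (K : fieldType) D n m
    (G : sgraph n) (H : sgraph m) :
  reduces_to G H -> (0 < m)%N ->
  gen_in_degree (@toric_ideal K _ G) D -> gen_in_degree (@toric_ideal K _ H) D.
Proof.
elim=> {m H} [|m H H' _ IH isoH|m H v _ IH|m H u v _ IH Huv] m_gt0 genG //.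
- have [a [b rab]] := graph_iso_retraction isoH.
  exact: (gen_in_degree_retract m_gt0 rab (IH m_gt0 genG)).
- have rH := delete_vertex_retraction H v.
  exact: (gen_in_degree_retract m_gt0 rH (IH isT genG)).
have rH := contract_edge_retraction Huv.
exact: (gen_in_degree_retract m_gt0 rH (IH isT genG)).
Qed.

Lemma reduces_to_size n m (G : sgraph n) (H : sgraph m) :
  reduces_to G H -> (m <= n)%N.
Proof. by elim=> // {m H}m *; exact: ltnW. Qed.

Theorem corollary4p2 (R : realType) (n m : nat) (G : sgraph n) (H : sgraph m) :
  is_minor H G ->
  (markov_width (complex R) H <= markov_width (complex R) G)%N.
Proof.
move=> [m_gt0 redGH].
have n_gt0 : (0 < n)%N := leq_trans m_gt0 (reduces_to_size redGH).
apply/largest_generator_degreeP; first exact: toric_ideal_is_ideal.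
  exact: toric_ideal_graded.
apply: gen_in_degree_reduces redGH m_gt0 _.
apply/largest_generator_degreeP; last exact: leqnn.
  exact: toric_ideal_is_ideal.
exact: toric_ideal_graded.
Qed.
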